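(* Let $B$ be a locally large band. Then the word problem of $\operatorname{IG}(B)$ is solvable.
   Context: A band is a semigroup all of whose elements are idempotent. Every band $B$ is a semilattice $Y$ of rectangular bands $B_\alpha$: $B=\bigcup_{\alpha\in Y}B_\alpha$ (disjoint union), each $B_\alpha$ is a rectangular band and $B_\alpha B_\beta\subseteq B_{\alpha\beta}$; $Y$ is ordered by $\alpha\leq\beta$ iff $\alpha\beta=\alpha$. The band $B$ is locally large if for all $\alpha,\beta\in Y$ with $\beta>\alpha$, $u\in B_\alpha$ and $v\in B_\beta$, we have $uv=vu=u$ (equivalently, $uv=vu=v$ for all $u,v\in B$ with $BvB\subsetneq BuB$). A pair $(e,f)\in B\times B$ is basic if $\{e,f\}\cap\{ef,fe\}\neq\emptyset$. The free idempotent generated semigroup over $B$ is given by the presentation $\operatorname{IG}(B)=\langle \overline{B} : \overline{e}\,\overline{f}=\overline{ef},\ (e,f)\text{ a basic pair}\rangle$ (as a semigroup), where $\overline{B}=\{\overline{e}:e\in B\}$ is a set of symbols in bijection with $B$. Thus $\operatorname{IG}(B)=\overline{B}^+/\rho$, where $\overline{B}^+$ is the free semigroup on $\overline{B}$ and $\rho$ is the congruence generated by the defining relations. A semigroup of the form $S=X^+/\rho$, with $\rho$ a congruence on $X^+$, has solvable word problem if there is an algorithm to decide when two elements of $X^+$ give the same element of $S$.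
   Formalization: B is assumed countable, its elements numbered by natural numbers, and its multiplication computable (possibly relative to an oracle that the algorithm may also use); without this the claim fails, e.g. for a countable chain with no computable copy. *)

(* Defs.v *)
From HB Require Import structures.
From mathcomp Require Import all_boot.
From Stdlib Require Cantor.

Set Implicit Arguments.
Unset Strict Implicit.
Unset Printing Implicit Defensive.

Local Open Scope group_scope.

(* Partial recursive functions relative to an oracle O : nat -> nat, in unary *)
(* form over the Cantor pairing.  Taking O to be constant (or any recursive   *)
(* function) gives the ordinary partial recursive functions.                  *)

Definition pair_code (a b : nat) : nat := Cantor.to_nat (a, b).

Inductive program : Type :=
| Zero
| Succ
| Fst
| Snd
| Oracle
| Pair of program & program
| Comp of program & program
| Prec of program & program
| Mu of program.

(* Partial functions as graphs: f x y means that f is defined at x with value *)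
(* y.  In prec_graph, (f, g) is iterated from the parameter a :               *)
(*   h 0 = f a   and   h n.+1 = g <a, <n, h n>>.                              *)
Fixpoint prec_graph (f g : nat -> nat -> Prop) (a n y : nat) : Prop :=
  if n is m.+1
  then exists2 r, prec_graph f g a m r & g (pair_code a (pair_code m r)) y
  else f a y.

Definition mu_graph (f : nat -> nat -> Prop) (a n : nat) : Prop :=
  f (pair_code a n) 0%N /\
  forall m, (m < n)%N -> exists k, f (pair_code a m) k.+1.

(* eval O p x y : program p with oracle O halts on input x and returns y.     *)
Fixpoint eval (O : nat -> nat) (p : program) (x y : nat) {struct p} : Prop :=
  match p with
  | Zero => y = 0%N
  | Succ => y = x.+1
  | Fst => y = (Cantor.of_nat x).1
  | Snd => y = (Cantor.of_nat x).2
  | Oracle => y = O x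
  | Pair f g => exists a b, [/\ eval O f x a, eval O g x b & y = pair_code a b]
  | Comp f g => exists2 z, eval O g x z & eval O f z y
  | Prec f g => prec_graph (eval O f) (eval O g)
                  (Cantor.of_nat x).1 (Cantor.of_nat x).2 y
  | Mu f => mu_graph (eval O f) x y
  end.

Lemma eval_functional O p x y z : eval O p x y -> eval O p x z -> y = z.
Proof.
elim: p x y z => [||||| f IHf g IHg | f IHf g IHg | f IHf g IHg | f IHf] x y z /=.
1-5: by move=> -> ->.
- by move=> [a [b [fa gb ->]]] [c [d [fc gd ->]]];
    rewrite (IHf _ _ _ fa fc) (IHg _ _ _ gb gd).
- by move=> [a ga fa] [b gb fb]; rewrite (IHg _ _ _ ga gb) in fa; apply: IHf fb.
- elim: (_.2) y z => [|n IHn] y z /=; first exact: IHf.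
  by move=> [r hr gr] [s hs]; rewrite -(IHn _ _ hr hs); apply: IHg.
- move=> [fy ltfy] [fz ltfz]; case: (ltngtP y z) => // lt.
  + by have [k /(IHf _ _ _ fy)] := ltfz _ lt.
  + by have [k /(IHf _ _ _ fz)] := ltfy _ lt.
Qed.

Definition fsemigroup (X : choiceType) : Type := {w : seq X | ~~ nilp w}.

HB.instance Definition _ (X : choiceType) := Choice.on (fsemigroup X).

Section FreeSemigroup.
Variable X : choiceType.
Implicit Types u v w : fsemigroup X.

Lemma fsemigroup_cat_subproof u v : ~~ nilp (val u ++ val v).
Proof. by case: u => [[|x s]]. Qed.

Definition fsemigroup_mul u v : fsemigroup X :=
  exist _ (val u ++ val v) (fsemigroup_cat_subproof u v).

Lemma fsemigroup_mulA : associative fsemigroup_mul.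
Proof. by move=> u v w; apply: val_inj; rewrite /= catA. Qed.

HB.instance Definition _ := isSemigroup.Build (fsemigroup X) fsemigroup_mulA.

Definition letter (x : X) : fsemigroup X := exist _ [:: x] isT.

End FreeSemigroup.

Inductive generated_congruence (S : semigroupType) (R : S -> S -> Prop) :
  S -> S -> Prop :=
| gc_rel x y : R x y -> generated_congruence R x y
| gc_refl x : generated_congruence R x x
| gc_sym x y : generated_congruence R x y -> generated_congruence R y x
| gc_trans x y z : generated_congruence R x y -> generated_congruence R y z ->
    generated_congruence R x z
| gc_mul x x' y y' : generated_congruence R x x' -> generated_congruence R y y' ->
    generated_congruence R (x * y) (x' * y').

Definition is_band (S : semigroupType) : Prop := forall x : S, x * x = x.

Definition is_semilattice (Y : semigroupType) : Prop :=
  is_band Y /\ forall a b : Y, a * b = b * a.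

Definition semilattice_lt (Y : semigroupType) (a b : Y) : Prop :=
  a * b = a /\ a <> b.

(* p presents the band B as a semilattice Y of rectangular bands, the         *)
(* component B_a being the fibre of p over a : Y.                             *)
Record rectangular_decomposition (B Y : semigroupType) (p : B -> Y) : Prop := {
  decomp_semilattice : is_semilattice Y;
  decomp_surj : forall a : Y, exists x : B, p x = a;
  decomp_morph : forall x y : B, p (x * y) = p x * p y;
  decomp_rect : forall x y : B, p x = p y -> x * y * x = x
}.

(* The decomposition of a band is unique up to isomorphism (its components    *)
(* are the J-classes), so that "exists" is as good as "for all" here.         *)
Definition locally_large (B : semigroupType) : Prop :=
  exists (Y : semigroupType) (p : B -> Y), rectangular_decomposition p /\
    forall u v : B, semilattice_lt (p u) (p v) -> u * v = u /\ v * u = u.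

Definition basic (S : semigroupType) (e f : S) : bool :=
  [|| e * f == e, e * f == f, f * e == e | f * e == f].

Variant IG_relation (B : semigroupType) : fsemigroup B -> fsemigroup B -> Prop :=
| IGRelation (e f : B) :
    basic e f -> IG_relation (letter e * letter f) (letter (e * f)).

(* IG(B) is the quotient of the free semigroup on B by this congruence.       *)
Definition IG_congruence (B : semigroupType) : fsemigroup B -> fsemigroup B -> Prop :=
  generated_congruence (@IG_relation B).

Definition word_code (X : choiceType) (num : X -> nat) (w : fsemigroup X) : nat :=
  foldr (fun x n => (pair_code (num x) n).+1) 0%N (val w).

(* With the elements of B numbered by num, multiplication is computable from  *)
(* O.  Programs are unconstrained on inputs that do not code elements of B.   *)
Definition computable_mul (O : nat -> nat) (B : semigroupType) (num : B -> nat) :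
    Prop :=
  exists m : program, forall x y : B,
    eval O m (pair_code (num x) (num y)) (num (x * y)).

Definition solvable_word_problem (O : nat -> nat) (X : choiceType) (num : X -> nat)
    (rho : fsemigroup X -> fsemigroup X -> Prop) : Prop :=
  exists d : program, forall u v : fsemigroup X,
    let input := pair_code (word_code num u) (word_code num v) in
    (rho u v -> eval O d input 1%N) /\ (~ rho u v -> eval O d input 0%N).

(* Main.v *)
Require Import Defs.
From mathcomp Require Import all_boot zify.
From Stdlib Require Cantor.

(* In a locally large band every basic pair (e, f) satisfies e f = e or       *)
(* e f = f.  This alone makes the length-reducing system e f -> (e f), over   *)
(* the basic pairs, confluent: if d e f is an overlap, then either d e = d    *)
(* and e f = f, and both reducts are d f, or the pairs (d e, f) and (d, e f)  *)
(* are again basic, and both reducts lead to the letter d e f.  Hence         *)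
(* reducing from left to right on a stack computes a normal form, and it uses *)
(* only the multiplication of B.                                              *)

Set Implicit Arguments.
Unset Strict Implicit.
Unset Printing Implicit Defensive.

Local Open Scope group_scope.

(** Words are compared through their normal forms. Local largeness enters through
    [locally_large_basic]. By [push_absorbing], pushing onto a reduced stack respects the defining
    relations, so congruent words have equal normal forms; conversely each merge applies a relation,
    so a word is congruent to its normal form ([IG_congruence_normal_formE]). The length of a word
    bounds the number of steps, so primitive recursion computes normal forms ([eval_Normal_form]),
    and injectivity of [num] lets their codes be compared. *)

Definition absorbing (B : semigroupType) (e f : B) : bool :=
  (e * f == e) || (e * f == f).

(** Suppose [f * e = e]. In a common component, rectangularity gives [e * f = f * e * f = f];
    otherwise [e] lies strictly below [f], and [e * f = e]. The case [f * e = f] is dual. *)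
Lemma locally_large_basic (B : semigroupType) (e f : B) :
  locally_large B -> basic e f = absorbing e f.
Proof.
move=> [Y [p [[[_ mulYC] _ pM pR] large]]]; rewrite /basic /absorbing.
have [//|ne] := eqVneq (e * f) e; have [//|nf] := eqVneq (e * f) f => /=.
apply/negbTE/norP; split; apply/eqP => fe.
- have [pef|pef] := eqVneq (p e) (p f).
    by move/eqP: nf; apply; rewrite -[in LHS]fe pR.
  have /large[ef _] : semilattice_lt (p e) (p f).
    by split; [rewrite mulYC -pM fe | apply/eqP].
  by rewrite ef eqxx in ne.
- have [pef|pef] := eqVneq (p e) (p f).
    by move/eqP: ne; apply; rewrite -[in LHS]fe mulgA pR.
  have /large[_ ef] : semilattice_lt (p f) (p e).
    by split; [rewrite -pM fe | apply/eqP; rewrite eq_sym].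
  by rewrite ef eqxx in nf.
Qed.

(** * Normal forms by stack reduction *)

Section Stack.
Variable B : semigroupType.
Implicit Types (d e f : B) (s t : seq B).

(* Stacks list the letters of a word from right to left. *)
Fixpoint push s f : seq B :=
  if s is e :: s' then
    if absorbing e f then push s' (e * f) else f :: s
  else [:: f].

Definition reduced s : bool := sorted (fun f e => ~~ absorbing e f) s.

Lemma reduced_push s f : reduced s -> reduced (push s f).
Proof.
elim: s f => [//|e s IHs] f red_es /=; case: ifPn => [_|ef].
  exact/IHs/(path_sorted red_es).
by rewrite /reduced /= ef.
Qed.

Lemma reduced_foldl_push s t : reduced s -> reduced (foldl push s t).
Proof. by elim: t s => [//|f t IHt] s /(reduced_push f)/IHt. Qed.

Lemma push_reduced e s : reduced (e :: s) -> push s e = e :: s.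
Proof. by case: s => [|d s] //= /andP[/negPf->]. Qed.

Lemma push_neq_nil s f : push s f != [::].
Proof. by elim: s f => [|e s IHs] f //=; case: ifP. Qed.

(** Confluence in stack form. If [d * e = d] and [e * f = f], pushing [e] must restore the stack
    [d :: s], which holds because that stack is reduced. *)
Lemma push_absorbing s e f :
  reduced s -> absorbing e f -> push (push s e) f = push s (e * f).
Proof.
elim: s e f => [|d s IHs] e f red_ds ef /=; first by rewrite ef.
have red_s := path_sorted red_ds.
case: ifPn => [de|_]; last by rewrite /= ef.
(* The other three cases reduce to this: both regrouped pairs are absorbing, so induction applies to
   [d * e] and [f]. *)
have mulK : absorbing (d * e) f -> absorbing d (e * f) ->
    push (push s (d * e)) f
    = (if absorbing d (e * f) then push s (d * (e * f))
       else e * f :: d :: s).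
  by move=> def1 def2; rewrite def2 IHs // mulgA.
case/orP: (de) => /eqP def_de; case/orP: (ef) => /eqP def_ef.
- have df : d * f = d by rewrite -{1}def_de -mulgA def_ef.
  by apply: mulK; rewrite ?def_ef // def_de /absorbing df eqxx.
- by rewrite def_de def_ef (push_reduced red_ds).
- by apply: mulK; rewrite ?def_de // def_ef.
- have df : d * f = f by rewrite -def_ef mulgA def_de.
  by apply: mulK; rewrite ?def_de // def_ef /absorbing df eqxx orbT.
Qed.

Definition normal_form s := foldl push [::] s.

Hypothesis basicE : forall e f, basic e f = absorbing e f.

(** The stack is arbitrary because, in a product, the second factor is pushed onto what the first
    one leaves. *)
Lemma IG_congruence_foldl_push (u v : fsemigroup B) s :
  IG_congruence u v -> reduced s -> foldl push s (val u) = foldl push s (val v).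
Proof.
move=> uv; elim: uv s => {u v} [_ _ [e f ef]|u|u v _ IH|u v w _ IHuv _ IHvw
  |u u' v v' _ IHu _ IHv] s red_s //.
- by rewrite /= push_absorbing // -basicE.
- by rewrite IH.
- by rewrite IHuv ?IHvw.
- by rewrite /= !foldl_cat IHu // IHv // reduced_foldl_push.
Qed.

(** Allows an empty context, which is not an element of the free semigroup and so escapes
    [gc_mul]. *)
Lemma IG_congruence_catl (u v u' v' : fsemigroup B) s :
  IG_congruence u v -> val u' = s ++ val u -> val v' = s ++ val v ->
  IG_congruence u' v'.
Proof.
case: s => [|x s] uv eq_u eq_v.
  by rewrite (val_inj (eq_u : val u' = val u)) (val_inj (eq_v : val v' = val v)).
pose w : fsemigroup B := exist _ (x :: s) isT.
have -> : u' = w * u by apply: val_inj.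
have -> : v' = w * v by apply: val_inj.
by apply: gc_mul uv; apply: gc_refl.
Qed.

Lemma IG_congruence_catr (u v u' v' : fsemigroup B) s :
  IG_congruence u v -> val u' = val u ++ s -> val v' = val v ++ s ->
  IG_congruence u' v'.
Proof.
case: s => [|x s] uv eq_u eq_v.
  by rewrite !cats0 in eq_u eq_v; rewrite (val_inj eq_u) (val_inj eq_v).
pose w : fsemigroup B := exist _ (x :: s) isT.
have -> : u' = u * w by apply: val_inj.
have -> : v' = v * w by apply: val_inj.
by apply: gc_mul; first exact: uv; apply: gc_refl.
Qed.

Lemma IG_congruence_push s f (u v : fsemigroup B) :
  val u = rcons (rev s) f -> val v = rev (push s f) -> IG_congruence u v.
Proof.
elim: s f u => [|e s IHs] f u /= eq_u eq_v.
  have -> : u = v by apply: val_inj; rewrite /= eq_u eq_v.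
  exact: gc_refl.
case: ifPn eq_v => [ef|_] eq_v; last first.
  have -> : u = v by apply: val_inj; rewrite /= eq_u eq_v [in RHS]rev_cons.
  exact: gc_refl.
have ne : ~~ nilp (rcons (rev s) (e * f)) by case: (rev s).
pose w : fsemigroup B := exist _ (rcons (rev s) (e * f)) ne.
apply: (@gc_trans _ _ _ w); last exact: IHs eq_v.
apply: (@IG_congruence_catl (letter e * letter f) (letter (e * f)) _ _ (rev s)).
- by apply/gc_rel/IGRelation; rewrite basicE.
- by rewrite /= eq_u rev_cons -!cats1 -catA.
- by rewrite /= cats1.
Qed.

Lemma IG_congruence_push_all s t (u v : fsemigroup B) :
  val u = rev s ++ t -> val v = rev (foldl push s t) -> IG_congruence u v.
Proof.
have nilp_push r f : ~~ nilp (rev (push r f)).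
  by rewrite /nilp size_rev size_eq0 push_neq_nil.
elim: t s u => [|f t IHt] s u /= eq_u eq_v.
  have -> : u = v by apply: val_inj; rewrite /= eq_u eq_v cats0.
  exact: gc_refl.
have ne_sf : ~~ nilp (rcons (rev s) f) by case: (rev s).
have ne : ~~ nilp (rev (push s f) ++ t).
  by have := nilp_push s f; case: (rev _).
pose w : fsemigroup B := exist _ (rev (push s f) ++ t) ne.
apply: (@gc_trans _ _ _ w); last exact: IHt eq_v.
pose w1 : fsemigroup B := exist _ (rcons (rev s) f) ne_sf.
pose w2 : fsemigroup B := exist _ (rev (push s f)) (nilp_push s f).
apply: (@IG_congruence_catr w1 w2 _ _ t).
- exact: IG_congruence_push.
- by rewrite /= eq_u cat_rcons.
- by [].
Qed.

Lemma IG_congruence_normal_formE (u v : fsemigroup B) :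
  IG_congruence u v <-> normal_form (val u) = normal_form (val v).
Proof.
split=> [uv|eq_uv]; first exact: IG_congruence_foldl_push.
have ne : ~~ nilp (rev (normal_form (val u))).
  rewrite /normal_form; case: u {eq_uv} => -[//|x t] _ /=.
  suffices: forall s, s != [::] -> ~~ nilp (rev (foldl push s t)) by apply.
  elim: t => [|f t IHt] s ne_s; first by rewrite /nilp size_rev size_eq0.
  exact/IHt/push_neq_nil.
pose w : fsemigroup B := exist _ (rev (normal_form (val u))) ne.
apply: (@gc_trans _ _ _ w); first exact: (@IG_congruence_push_all [::] (val u)).
apply/gc_sym/(@IG_congruence_push_all [::] (val v)) => //.
by rewrite -/(normal_form _) -eq_uv.
Qed.

(* A state is the stack together with the letters that remain to be pushed.   *)
Definition push_step (st : seq B * seq B) : seq B * seq B :=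
  if st.2 is f :: t then
    if st.1 is e :: s then
      if absorbing e f then (s, e * f :: t) else (f :: st.1, t)
    else ([:: f], t)
  else st.

(** While letters remain, each step lowers the measure by one: a merge shortens the stack, a shift
    turns a letter of weight 2 into one of weight 1. Final states are fixed, so extra steps are
    harmless. *)
Lemma iter_push_step n s t :
  (size s + (size t).*2 <= n)%N -> iter n push_step (s, t) = (foldl push s t, [::]).
Proof.
elim: n s t => [|n IHn] s t; first by case: s t => [|e s] [|f t].
rewrite iterSr {2}/push_step.
case: t => [|f t] /=; first by move=> _; elim: n {IHn} => //= n ->.
case: s => [|e s] /=; first by rewrite doubleS => le_n; rewrite IHn.
by case: ifP => _ le_n; rewrite IHn //=; lia.
Qed.

End Stack.

(** * Programs for arithmetic and branching *)

Section Programs.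
Variable O : nat -> nat.
Implicit Types (p q c f g h : program) (x y z a b n : nat).

Lemma of_natK x : pair_code (Cantor.of_nat x).1 (Cantor.of_nat x).2 = x.
Proof. by rewrite /pair_code -surjective_pairing Cantor.cancel_to_of. Qed.

Lemma pair_codeK a b : Cantor.of_nat (pair_code a b) = (a, b).
Proof. exact: Cantor.cancel_of_to. Qed.

Lemma eval_Fst p x a b : eval O p x (pair_code a b) -> eval O (Comp Fst p) x a.
Proof. by move=> px; exists (pair_code a b); rewrite //= pair_codeK. Qed.

Lemma eval_Snd p x a b : eval O p x (pair_code a b) -> eval O (Comp Snd p) x b.
Proof. by move=> px; exists (pair_code a b); rewrite //= pair_codeK. Qed.

Lemma eval_Succ p x y : eval O p x y -> eval O (Comp Succ p) x y.+1.
Proof. by move=> px; exists y. Qed.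

Lemma eval_Comp p q x y z : eval O q x y -> eval O p y z -> eval O (Comp p q) x z.
Proof. by move=> qx py; exists y. Qed.

Lemma eval_Pair p q x a b :
  eval O p x a -> eval O q x b -> eval O (Pair p q) x (pair_code a b).
Proof. by move=> px qx; exists a, b. Qed.

Definition Id : program := Pair Fst Snd.

Lemma eval_Id x : eval O Id x x.
Proof. by rewrite -{2}[x]of_natK; apply: eval_Pair. Qed.

Definition One : program := Comp Succ Zero.

Lemma eval_One x : eval O One x 1.
Proof. exact: eval_Succ. Qed.

Lemma eval_Prec f g a n (h : nat -> nat) :
  eval O f a (h 0) ->
  (forall m, (m < n)%N -> eval O g (pair_code a (pair_code m (h m))) (h m.+1)) ->
  eval O (Prec f g) (pair_code a n) (h n).
Proof.
move=> f0 gS /=; rewrite pair_codeK /=.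
elim: n gS => //= n IHn gS; exists (h n); last exact: gS.
by apply: IHn => m lt_mn; apply/gS/ltnW.
Qed.

Definition Pred : program := Comp (Prec Zero (Comp Fst Snd)) (Pair Zero Id).

Lemma eval_Pred p x y : eval O p x y -> eval O (Comp Pred p) x y.-1.
Proof.
move=> px; apply: eval_Comp px _; apply: eval_Comp (_ : eval O _ _ (pair_code 0 y)) _.
  by apply: eval_Pair (eval_Id _).
by apply: (eval_Prec (h := predn)) => // m _; apply: eval_Fst; rewrite /= pair_codeK.
Qed.

Definition Sub p q : program := Comp (Prec Id (Comp Pred (Comp Snd Snd))) (Pair p q).

Lemma eval_Sub p q x a b :
  eval O p x a -> eval O q x b -> eval O (Sub p q) x (a - b).
Proof.
move=> px qx; apply: eval_Comp (eval_Pair px qx) _.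
apply: (eval_Prec (h := subn a)) => [|m _]; first by rewrite subn0; apply: eval_Id.
by rewrite subnS; apply/eval_Pred/eval_Snd; rewrite /= pair_codeK.
Qed.

(* If c then g else h, running only the branch that is selected: each branch  *)
(* is the step of a recursion that is iterated zero times if the branch is    *)
(* not selected.                                                              *)
Definition If c g h : program :=
  Comp (Prec Snd (Comp Fst Fst))
    (Pair (Pair (Comp (Prec Zero (Comp g Fst)) (Pair Id c))
                (Comp (Prec Zero (Comp h Fst)) (Pair Id (Sub One c)))) c).

(** When [v] is 0, [g] may diverge. This matters since [m] need not halt on inputs that do not code
    letters. *)
Lemma eval_guard c g x v y :
  eval O c x v -> ((0 < v)%N -> eval O g x y) ->
  eval O (Comp (Prec Zero (Comp g Fst)) (Pair Id c)) x (if (0 < v)%N then y else 0).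
Proof.
move=> cx gx; apply: eval_Comp (eval_Pair (eval_Id x) cx) _.
apply: (eval_Prec (h := fun v => if (0 < v)%N then y else 0)) => // m lt_mv.
apply: (eval_Comp (y := x)); first by rewrite /= pair_codeK.
by apply/gx/(leq_trans _ lt_mv).
Qed.

Lemma eval_If c g h x v y :
  eval O c x v -> ((0 < v)%N -> eval O g x y) -> (v = 0 -> eval O h x y) ->
  eval O (If c g h) x y.
Proof.
move=> cx gx hx.
have hx' : (0 < 1 - v)%N -> eval O h x y by rewrite subn_gt0 ltnS leqn0 => /eqP.
have gv := eval_guard cx gx.
have hv := eval_guard (eval_Sub (eval_One x) cx) hx'.
apply: eval_Comp (eval_Pair (eval_Pair gv hv) cx) _.
case: v {cx gx hx hx' gv hv} => [|v].
  by apply: (eval_Prec (h := fun=> y)) => //=; rewrite pair_codeK.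
rewrite subSS sub0n ltnn ltn0Sn.
apply: (eval_Prec (n := v.+1) (h := fun n => if (0 < n)%N then y else 0)) => [|m _].
  by rewrite /= pair_codeK.
by apply: eval_Fst; rewrite /= pair_codeK.
Qed.

Lemma eval_If_bool c g h x (b : bool) y z :
  eval O c x b -> (b -> eval O g x y) -> (~~ b -> eval O h x z) ->
  eval O (If c g h) x (if b then y else z).
Proof.
case: b => cx gx hx; apply: (eval_If cx) => // _; by [apply: gx | apply: hx].
Qed.

Definition Eqn p q : program := If (Sub p q) Zero (If (Sub q p) Zero One).

Lemma eval_Eqn p q x a b :
  eval O p x a -> eval O q x b -> eval O (Eqn p q) x (a == b).
Proof.
move=> px qx; apply: eval_If (eval_Sub px qx) _ _ => [|/eqP].
  by rewrite subn_gt0 => /gtn_eqF->.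
rewrite subn_eq0 => le_ab; apply: eval_If (eval_Sub qx px) _ _ => [|/eqP].
  by rewrite subn_gt0 => /ltn_eqF->.
by rewrite subn_eq0 eqn_leq le_ab => ->; apply: eval_One.
Qed.

Definition Cons p q : program := Comp Succ (Pair p q).
Definition Head p : program := Comp Fst (Comp Pred p).
Definition Tail p : program := Comp Snd (Comp Pred p).

(** * Programs on coded words *)

Section Words.
Variables (B : semigroupType) (num : B -> nat).
Hypothesis num_inj : injective num.
Variable m : program.
Hypothesis mE : forall e f : B, eval O m (pair_code (num e) (num f)) (num (e * f)).

Definition seq_code (s : seq B) : nat :=
  foldr (fun e n => (pair_code (num e) n).+1) 0 s.

Lemma seq_code_inj : injective seq_code.
Proof.
elim=> [|e s IHs] [|f t] //= [/(congr1 Cantor.of_nat)].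
by rewrite !pair_codeK => -[/num_inj-> /IHs->].
Qed.

Lemma eval_Cons p q x e s :
  eval O p x (num e) -> eval O q x (seq_code s) ->
  eval O (Cons p q) x (seq_code (e :: s)).
Proof. by move=> px qx; apply/eval_Succ/eval_Pair. Qed.

Lemma eval_Head p x e s : eval O p x (seq_code (e :: s)) -> eval O (Head p) x (num e).
Proof. by move/eval_Pred/eval_Fst. Qed.

Lemma eval_Tail p x e s :
  eval O p x (seq_code (e :: s)) -> eval O (Tail p) x (seq_code s).
Proof. by move/eval_Pred/eval_Snd. Qed.

Definition Absorbing p q : program :=
  If (Eqn (Comp m (Pair p q)) p) One (Eqn (Comp m (Pair p q)) q).

Lemma eval_Absorbing p q x (e f : B) :
  eval O p x (num e) -> eval O q x (num f) ->
  eval O (Absorbing p q) x (absorbing e f).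
Proof.
move=> px qx; have mx := eval_Comp (eval_Pair px qx) (mE e f).
rewrite /absorbing -!(inj_eq num_inj).
apply: eval_If (eval_Eqn mx px) _ _; first by case: eqP => // _ _; apply: eval_One.
by case: eqP => // _ _; apply: eval_Eqn.
Qed.

Definition state_code (st : seq B * seq B) : nat :=
  pair_code (seq_code st.1) (seq_code st.2).

(** Only the empty list has code 0, so [Fst] and [Snd] serve as nonemptiness tests; the inner [If]
    keeps [m] from running on an empty stack. *)
Definition Push_step : program :=
  If Snd
    (If (If Fst (Absorbing (Head Fst) (Head Snd)) Zero)
       (Pair (Tail Fst) (Cons (Comp m (Pair (Head Fst) (Head Snd))) (Tail Snd)))
       (Pair (Cons (Head Snd) Fst) (Tail Snd)))
    Id.

Lemma eval_Push_step (st : seq B * seq B) :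
  eval O Push_step (state_code st) (state_code (push_step st)).
Proof.
case: st => s t; have eFst : eval O Fst (state_code (s, t)) (seq_code s).
  by rewrite /= pair_codeK.
have eSnd : eval O Snd (state_code (s, t)) (seq_code t) by rewrite /= pair_codeK.
case: t eFst eSnd => [|f t] eFst eSnd.
  by apply: (eval_If eSnd) => // _; apply: eval_Id.
apply: (eval_If eSnd) => // _.
have eShift := eval_Pair (eval_Cons (eval_Head eSnd) eFst) (eval_Tail eSnd).
case: s eFst eSnd eShift => [|e s] eFst eSnd eShift.
  by apply: eval_If (_ : eval O _ _ 0) _ _ => //; apply: (eval_If eFst).
have eAbs := eval_Absorbing (eval_Head eFst) (eval_Head eSnd).
rewrite /push_step (fun_if state_code).
apply: eval_If_bool => [|_|_]; [by apply: (eval_If eFst) | | exact: eShift].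
apply: eval_Pair (eval_Tail eFst) _; apply: eval_Cons (eval_Tail eSnd).
exact: eval_Comp (eval_Pair (eval_Head eFst) (eval_Head eSnd)) (mE e f).
Qed.

(* The code of a word bounds its length, and two machine steps per letter     *)
(* suffice.                                                                   *)
Definition Normal_form : program :=
  Comp Fst
    (Comp (Prec (Pair Zero Id) (Comp (Comp Push_step Push_step) (Comp Snd Snd)))
          (Pair Id Id)).

Lemma size_le_seq_code s : (size s <= seq_code s)%N.
Proof.
elim: s => //= e s IHs; apply: leq_trans IHs _.
by rewrite /pair_code /=; lia.
Qed.

Lemma eval_Normal_form s :
  eval O Normal_form (seq_code s) (seq_code (normal_form s)).
Proof.
apply: (eval_Fst (b := seq_code [::])).
apply: eval_Comp (eval_Pair (eval_Id _) (eval_Id _)) _.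
pose h n := state_code (iter n.*2 (@push_step B) ([::], s)).
have -> : pair_code (seq_code (normal_form s)) (seq_code [::]) = h (seq_code s).
  by rewrite /h iter_push_step // add0n leq_double size_le_seq_code.
apply: eval_Prec => [|n _]; first by apply: eval_Pair (eval_Id _).
apply: (eval_Comp (y := h n)); first by apply: eval_Snd; rewrite /= pair_codeK.
exact: eval_Comp (eval_Push_step _) (eval_Push_step _).
Qed.

End Words.
End Programs.

Theorem theorem6p5 (B : semigroupType) (bandB : is_band B)
    (largeB : locally_large B)
    (num : B -> nat) (num_inj : injective num)
    (O : nat -> nat) (mulB : computable_mul O num) :
  solvable_word_problem O num (@IG_congruence B).
Proof.
have [m mE] := mulB.
have basicE (e f : B) : basic e f = absorbing e f by exact: locally_large_basic.
exists (Eqn (Comp (Normal_form m) Fst) (Comp (Normal_form m) Snd)) => u v /=.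
set x := pair_code _ _.
(* The output is a boolean read as 0 or 1, so this one evaluation yields both halves of the
   specification. *)
have eq_uv : eval O (Eqn (Comp (Normal_form m) Fst) (Comp (Normal_form m) Snd)) x
    (normal_form (val u) == normal_form (val v)).
  rewrite -(inj_eq (seq_code_inj num_inj)).
  by apply: eval_Eqn; apply: eval_Comp (eval_Normal_form num_inj mE _);
    rewrite /= pair_codeK.
split=> [/(IG_congruence_normal_formE basicE)/eqP eq_nf|ne_uv].
  by rewrite eq_nf in eq_uv.
suffices /negPf ne : normal_form (val u) != normal_form (val v) by rewrite ne in eq_uv.
by apply/eqP => /(IG_congruence_normal_formE basicE).
Qed.
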